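(* Let $A\in\mathbb{R}^{n\times n}$, $B\in\mathbb{R}^{n\times m}$, $C\in\mathbb{R}^{m\times n}$, $D\in\mathbb{R}^{m\times m}$, and let $P,S\in\mathbb{R}^{n\times n}$ satisfy $S^\top P=P^\top S$, $\operatorname{rank}\begin{bmatrix} P \\ S \end{bmatrix}=n$, and the generalized dissipation inequality $$\begin{bmatrix} S^\top AP+P^\top A^\top S & S^\top B-P^\top C^\top \\ B^\top S-CP & -D-D^\top \end{bmatrix}\le 0 .$$ By allowing for coordinate transformations on the state space $\mathcal{X}$ and on the parametrization space $\mathcal{Z}$ one can always transform $P$ to the form $$P=\begin{bmatrix} I_k & 0 \\ 0 & 0 \end{bmatrix},\qquad k=\operatorname{rank}P .$$ Using $S^\top P=P^\top S$ it follows that $S$ needs to be of the corresponding form $$S=\begin{bmatrix} S_{11} & 0 \\ 0 & S_{22} \end{bmatrix},\quad S_{11}=S_{11}^\top,\ S_{22}=S_{22}^\top,$$ and, since $\operatorname{rank}\begin{bmatrix} P \\ S \end{bmatrix}=n$, $S_{22}$ is invertible. In such coordinates, with $A,B,C$ partitioned accordingly, the generalized dissipation inequality takes the form $$\begin{bmatrix} A_{11}^\top S_{11}+S_{11}A_{11} & A_{21}^\top S_{22} & S_{11}B_1-C_1^\top \\ S_{22}A_{21} & 0 & S_{22}B_2 \\ B_1^\top S_{11}-C_1 & B_2^\top S_{22} & -D-D^\top \end{bmatrix}\le 0 ,$$ which implies $A_{21}=0$ and $B_2=0$. Hence the system $\dot x=Ax+Bu$, $y=Cx+Du$ takes the block-triangular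 form $$\dot x_1=A_{11}x_1+A_{12}x_2+B_1u,\qquad \dot x_2=A_{22}x_2,\qquad y=C_1x_1+C_2x_2+Du,$$ satisfying the reduced dissipation inequality $$\begin{bmatrix} A_{11}^\top S_{11}+S_{11}A_{11} & S_{11}B_1-C_1^\top \\ B_1^\top S_{11}-C_1 & -D-D^\top \end{bmatrix}\le 0 .$$ In particular, for any initial condition $x(0)$ with $x_2(0)=0$ the system leads to the reduced system $\dot x_1=A_{11}x_1+B_1u$, $y=C_1x_1+Du$, which satisfies the dissipation inequality with storage function $\tfrac12 x_1^\top S_{11}x_1$. Furthermore, any system $\dot x=Ax+Bu$, $y=Cx+Du$ satisfying the generalized dissipation inequality with $P$ singular is necessarily uncontrollable; in fact, the controllable part of the system is contained in $\operatorname{im}P$.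
   Context: For a symmetric real matrix $X$, $X\le 0$ means negative semidefinite. $\mathcal{X}$ is the $n$-dimensional state space, with elements $x$, and $\mathcal{X}^*$ its dual space, with elements $p$. The subspace $\mathcal{L}=\operatorname{im}\begin{bmatrix} P \\ S \end{bmatrix}\subset\mathcal{X}\times\mathcal{X}^*$ is a Lagrange subspace, parametrized by $x=Pz$, $p=Sz$ with $z$ in the $n$-dimensional parametrization space $\mathcal{Z}$. A coordinate transformation on $\mathcal{X}$ is accompanied by the dual transformation on $\mathcal{X}^*$. After the transformation, the matrices are denoted by the same letters. The block partitioning has first block of size $k$, and $x=\begin{bmatrix} x_1 \\ x_2 \end{bmatrix}$ accordingly.
   Formalization: With P=diag(I_k,0), S^T P=P^T S only forces S11 symmetric and S12=0 (P=diag(1,0), S=[0 0;1 1] has S21=1); so S21=0 and S22 symmetric are obtained by a further coordinate change on Z that keeps P, S11 and the coordinates on X. *)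

(* Defs.v *)
From mathcomp Require Export all_boot all_order all_algebra.
From mathcomp Require Export all_classical all_reals all_analysis.
Export Order.TTheory GRing.Theory Num.Theory numFieldNormedType.Exports.
#[export] Set Implicit Arguments.
#[export] Unset Strict Implicit.
#[export] Unset Printing Implicit Defensive.
Local Open Scope classical_set_scope.
Local Open Scope ring_scope.

(* X <= 0 for a symmetric real matrix X *)
Definition nsd (R : realType) (n : nat) (X : 'M[R]_n) : Prop :=
  X^T = X /\ forall v : 'cV[R]_n, (v^T *m X *m v) 0 0 <= 0.

Definition gdi_mx (R : realType) (n m : nat) (A : 'M[R]_n) (B : 'M[R]_(n, m))
    (C : 'M[R]_(m, n)) (D : 'M[R]_m) (P S : 'M[R]_n) : 'M[R]_(n + m) :=
  block_mx (S^T *m A *m P + P^T *m A^T *m S) (S^T *m B - P^T *m C^T)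
           (B^T *m S - C *m P)               (- D - D^T).

(* A change of coordinates x = V *m x' between an n-dimensional space with
   coordinates x and new coordinates x' in R^n'.  Such a V exists only when
   n = n'; the two sizes are kept apart so that n' can syntactically be a sum
   k + l, which is what the block operations on matrices require. *)
Record coord_change (R : realType) (n n' : nat) := CoordChange {
  cc_mx :> 'M[R]_(n, n');
  cc_inv : 'M[R]_(n', n);
  cc_mxK : cc_mx *m cc_inv = 1%:M;
  cc_invK : cc_inv *m cc_mx = 1%:M
}.

(* The data in the coordinates x = V x', p' = V^T p (dual coordinates), and
   z = W z'. *)
Section Transformed.
Variables (R : realType) (n n' m : nat).
Implicit Types V W : coord_change R n n'.

Definition newA V (A : 'M[R]_n) : 'M[R]_n' := cc_inv V *m A *m V.
Definition newB V (B : 'M[R]_(n, m)) : 'M[R]_(n', m) := cc_inv V *m B.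
Definition newC V (C : 'M[R]_(m, n)) : 'M[R]_(m, n') := C *m V.
Definition newP V W (P : 'M[R]_n) : 'M[R]_n' := cc_inv V *m P *m W.
Definition newS V W (S : 'M[R]_n) : 'M[R]_n' := (cc_mx V)^T *m S *m W.

End Transformed.

(* Classical solutions on [0, T]: continuous on [0, T] and differentiable with
   derivative f t at every t in ]0, T[. *)
Definition solves_ode (R : realType) (n : nat) (T : R) (x f : R -> 'cV[R]_n)
    : Prop :=
  {within `[0, T], continuous x} /\
  forall t : R, t \in `]0, T[ -> is_derive t 1 x (f t).

Definition trajectory (R : realType) (n m : nat) (A : 'M[R]_n)
    (B : 'M[R]_(n, m)) (C : 'M[R]_(m, n)) (D : 'M[R]_m) (T : R)
    (x : R -> 'cV[R]_n) (u y : R -> 'cV[R]_m) : Prop :=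
  solves_ode T x (fun t => A *m x t + B *m u t) /\
  forall t : R, t \in `[0, T] -> y t = C *m x t + D *m u t.

(* Differential form: d/dt H(x(t)) <= y(t)^T u(t) along every trajectory. *)
Definition dissipation_inequality (R : realType) (n m : nat) (A : 'M[R]_n)
    (B : 'M[R]_(n, m)) (C : 'M[R]_(m, n)) (D : 'M[R]_m)
    (H : 'cV[R]_n -> R) : Prop :=
  forall (T : R) (x : R -> 'cV[R]_n) (u y : R -> 'cV[R]_m), 0 < T ->
    trajectory A B C D T x u y ->
    forall t : R, t \in `]0, T[ ->
      derivable (H \o x) t 1 /\
      'D_1 (H \o x) t <= ((y t)^T *m u t) 0 0.

Definition quadratic_storage (R : realType) (n : nat) (Q : 'M[R]_n)
    (x : 'cV[R]_n) : R := 2^-1 * (x^T *m Q *m x) 0 0.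

Definition im_mx (R : realType) (n p : nat) (M : 'M[R]_(n, p))
    : set 'cV[R]_n := range (fun z : 'cV[R]_p => M *m z).

(* The input u steers the state from x0 to x1 in some time T > 0. *)
Definition steerable (R : realType) (n m : nat) (A : 'M[R]_n)
    (B : 'M[R]_(n, m)) (x0 x1 : 'cV[R]_n) : Prop :=
  exists (T : R) (x : R -> 'cV[R]_n) (u : R -> 'cV[R]_m),
    [/\ 0 < T, solves_ode T x (fun t => A *m x t + B *m u t),
        x 0 = x0 & x T = x1].

Definition controllable (R : realType) (n m : nat) (A : 'M[R]_n)
    (B : 'M[R]_(n, m)) : Prop :=
  forall x0 x1 : 'cV[R]_n, steerable A B x0 x1.

Definition reachable_from_0 (R : realType) (n m : nat) (A : 'M[R]_n)
    (B : 'M[R]_(n, m)) : set 'cV[R]_n :=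
  [set x1 | steerable A B 0 x1].

(* im [B  A B  ...  A^(n-1) B] *)
Definition controllable_subspace (R : realType) (n m : nat) (A : 'M[R]_n)
    (B : 'M[R]_(n, m)) : set 'cV[R]_n :=
  im_mx (\mxrow_(j < n) (A ^+ j *m B)).

(* Main.v *)
Require Import Defs.
From mathcomp Require Import ring lra.
Local Open Scope classical_set_scope.
Local Open Scope ring_scope.

(** The (1,2) block of [S^T P = P^T S] kills [S12], and the rank condition then
   makes [S22] invertible.  A negative semidefinite matrix with a zero diagonal
   block has zero off-diagonal blocks next to it, so [S22 A21 = 0] and
   [S22 B2 = 0].  The remaining analytic point is that a solution of
   [x2' = A22 x2] with [x2(0) = 0] vanishes; this follows from the fact that
   [exp(-2 c t) |x2(t)|^2] is nonincreasing as soon as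
   [v^T A22 v <= c |v|^2] for all [v]. *)

(** * Differentiation and continuity of matrix-valued functions *)

Lemma is_derive_mxP (R : realType) (V : normedModType R) (m n : nat)
    (M : V -> 'M[R]_(m, n)) (dM : 'M[R]_(m, n)) (t v : V) :
  is_derive t v M dM <->
  forall i j, is_derive t v (fun x => M x i j) (dM i j).
Proof.
split=> [[dfM <-] i j|H].
  apply: DeriveDef; first by move/derivable_mxP: dfM.
  by rewrite derive_mx// mxE.
have dfM : derivable M t v by apply/derivable_mxP => i j; have [] := H i j.
apply: DeriveDef => //.
by rewrite derive_mx//; apply/matrixP => i j; rewrite mxE; have [] := H i j.
Qed.

Lemma is_derive_mulmx (R : realType) (V : normedModType R) (m n p : nat)
    (M : V -> 'M[R]_(m, n)) (N : V -> 'M[R]_(n, p)) dM dN (t v : V) :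
  is_derive t v M dM -> is_derive t v N dN ->
  is_derive t v (fun x => M x *m N x) (dM *m N t + M t *m dN).
Proof.
move=> /is_derive_mxP hM /is_derive_mxP hN; apply/is_derive_mxP => i j.
have -> : (fun x => (M x *m N x) i j) =
    \sum_(k < n) ((fun x => M x i k) * (fun x => N x k j)).
  by apply/funext => x; rewrite fct_sumE mxE.
have hMN k := @is_deriveM _ _ (fun x => M x i k) (fun x => N x k j) t v
  _ _ (hM i k) (hN k j).
have := @is_derive_sum _ _ _ _ _ _ _ _ hMN.
move=> h; apply: (is_derive_eq h).
rewrite !mxE -big_split/=; apply: eq_bigr => k _.
by rewrite /GRing.scale/= addrC mulrC; congr (_ + _); rewrite mulrC.
Qed.

Lemma is_derive_trmx (R : realType) (V : normedModType R) (m n : nat)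
    (M : V -> 'M[R]_(m, n)) dM (t v : V) :
  is_derive t v M dM -> is_derive t v (fun x => (M x)^T) dM^T.
Proof.
move=> /is_derive_mxP hM; apply/is_derive_mxP => i j; rewrite mxE.
have -> : (fun x => (M x)^T i j) = (fun x => M x j i).
  by apply/funext => x; rewrite mxE.
exact: hM.
Qed.

Lemma is_derive_mulmxr (R : realType) (V : normedModType R) (m n p : nat)
    (M : 'M[R]_(m, n)) (N : V -> 'M[R]_(n, p)) dN (t v : V) :
  is_derive t v N dN -> is_derive t v (fun x => M *m N x) (M *m dN).
Proof.
move=> hN; have hM : is_derive t v (fun=> M) 0 by exact: is_derive_cst.
by apply: (is_derive_eq (is_derive_mulmx hM hN)); rewrite mul0mx add0r.
Qed.

(** The product rule gives two scalar terms; symmetry of [Q] makes them transposes of each other,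
    hence equal. *)
Lemma is_derive_qform (R : realType) (V : normedModType R) (n : nat)
    (Q : 'M[R]_n) (x : V -> 'cV[R]_n) dx (t v : V) :
  Q^T = Q -> is_derive t v x dx ->
  is_derive t v (fun s => ((x s)^T *m Q *m x s) 0 0)
    (2 * ((x t)^T *m Q *m dx) 0 0).
Proof.
move=> QT hx.
have h : is_derive t v (fun s => (x s)^T *m (Q *m x s))
    (dx^T *m (Q *m x t) + (x t)^T *m (Q *m dx)).
  exact: is_derive_mulmx (is_derive_trmx hx) (is_derive_mulmxr Q hx).
have {}h := (is_derive_mxP _ _ _ _).1 h 0 0.
have -> : (fun s => ((x s)^T *m Q *m x s) 0 0) =
    (fun s => ((x s)^T *m (Q *m x s)) 0 0).
  by apply/funext => s; rewrite mulmxA.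
have dxT : dx^T *m (Q *m x t) = ((x t)^T *m Q *m dx)^T.
  by rewrite !trmx_mul trmxK QT mulmxA.
by apply: (is_derive_eq h); rewrite dxT mulmxA mxE mxE mulr_natl mulr2n.
Qed.

(** The norm of a matrix is a maximum over finitely many entries. The domain is an arbitrary
    topological space so that the subspace topology of [[0, T]] is covered. *)
Lemma continuous_mxP (R : realType) (T : topologicalType) (m n : nat)
    (M : T -> 'M[R]_(m, n)) :
  continuous M <-> forall i j, continuous (fun x => M x i j).
Proof.
split=> [cM i j x|cM x].
  exact: (@continuous_comp _ _ _ M (fun N : 'M[R]_(m, n) => N i j) x (cM x)
    (@coord_continuous _ _ _ i j _)).
apply/cvgrPdist_le => /= e e0.
near=> y.
rewrite /Num.Def.normr/= mx_normrE (bigmax_le _ (ltW e0))//= => i _.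
rewrite !mxE/=.
move: i; near: y; apply: filter_forall => /= i.
by apply: ((cvgrPdist_le _ _).1 (cM i.1 i.2 x)).
Unshelve. all: by end_near. Qed.

Lemma continuous_mulmx (R : realType) (T : topologicalType) (m n p : nat)
    (M : T -> 'M[R]_(m, n)) (N : T -> 'M[R]_(n, p)) :
  continuous M -> continuous N -> continuous (fun x => M x *m N x).
Proof.
move=> /continuous_mxP cM /continuous_mxP cN; apply/continuous_mxP => i j x.
have -> : (fun x => (M x *m N x) i j) =
    (fun x => \sum_(k < n) (M x i k * N x k j)).
  by apply/funext => y; rewrite mxE.
apply: cvg_big => [|k _]; first exact: add_continuous.
by apply: cvgM; [exact: cM|exact: cN].
Qed.

Lemma continuous_trmx (R : realType) (T : topologicalType) (m n : nat)
    (M : T -> 'M[R]_(m, n)) :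
  continuous M -> continuous (fun x => (M x)^T).
Proof.
move=> /continuous_mxP cM; apply/continuous_mxP => i j.
have -> : (fun x => (M x)^T i j) = (fun x => M x j i).
  by apply/funext => x; rewrite mxE.
exact: cM.
Qed.

Lemma continuous_mulmxr (R : realType) (T : topologicalType) (m n p : nat)
    (M : 'M[R]_(m, n)) (N : T -> 'M[R]_(n, p)) :
  continuous N -> continuous (fun x => M *m N x).
Proof. by move=> cN; apply: continuous_mulmx => // x; exact: cvg_cst. Qed.

(** * Solutions of differential equations and uniqueness of the zero solution *)

Lemma solves_ode_mulmx (R : realType) (n p : nat) (T : R) (M : 'M[R]_(p, n))
    (x f : R -> 'cV[R]_n) :
  solves_ode T x f ->
  solves_ode T (fun t => M *m x t) (fun t => M *m f t).
Proof.
move=> [cx dx]; split; first exact: continuous_mulmxr.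
by move=> t tT; apply: is_derive_mulmxr; exact: dx.
Qed.

Lemma solves_odeD (R : realType) (n : nat) (T : R) (x y f g : R -> 'cV[R]_n) :
  solves_ode T x f -> solves_ode T y g ->
  solves_ode T (fun t => x t + y t) (fun t => f t + g t).
Proof.
move=> [cx dx] [cy dy]; split.
  by move=> t; apply: cvgD; [exact: cx|exact: cy].
by move=> t tT; apply: is_deriveD; [exact: dx|exact: dy].
Qed.

(** Continuity concerns only values on [[0, T]], and the derivative at a point of []0, T[] only
    values in a neighbourhood that stays inside this interval. *)
Lemma eq_solves_ode (R : realType) (n : nat) (T : R) (x y f g : R -> 'cV[R]_n) :
  (forall t, t \in `[0, T] -> x t = y t) ->
  (forall t, t \in `]0, T[ -> f t = g t) ->
  solves_ode T x f -> solves_ode T y g.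
Proof.
move=> exy efg [cx dx]; split.
  by apply: subspace_eq_continuous cx => t; rewrite inE/=; exact: exy.
move=> t tT; rewrite -efg//; apply: near_eq_is_derive (dx t tT).
near=> s; apply: exy.
apply: subset_itv_oo_cc.
by near: s; exact: near_in_itvoo.
Unshelve. all: by end_near. Qed.

Lemma qform_le (R : realType) (n : nat) (A : 'M[R]_n) :
  exists c : R, forall v : 'cV[R]_n,
    (v^T *m A *m v) 0 0 <= c * (v^T *m v) 0 0.
Proof.
exists (\sum_i \sum_j `|A i j|) => v.
have le_vv i : v i 0 ^+ 2 <= (v^T *m v) 0 0.
  rewrite mxE (bigD1 i)//= mxE expr2 lerDl sumr_ge0// => j _.
  by rewrite mxE -expr2 sqr_ge0.
rewrite -mulmxA mxE mulr_suml ler_sum// => i _.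
move: ((v^T *m v) 0 0) le_vv => w le_vv.
rewrite !mxE mulr_sumr mulr_suml ler_sum// => j _.
apply: (le_trans (ler_norm _)).
rewrite mulrCA normrM ler_wpM2l// normrM.
have := le_vv i; have := le_vv j.
rewrite -(real_normK (num_real (v i 0))) -(real_normK (num_real (v j 0))).
(* This square bounds [|v_i| |v_j|] by half of [v_i^2 + v_j^2], hence by [v^T v]; summing against
   [|A i j|] gives the constant. *)
have := sqr_ge0 (`|v i 0| - `|v j 0|).
rewrite sqrrB; lra.
Qed.

Lemma solves_ode_unique0 (R : realType) (n : nat) (T : R) (A : 'M[R]_n)
    (x : R -> 'cV[R]_n) :
  0 < T -> solves_ode T x (fun t => A *m x t) -> x 0 = 0 ->
  forall t, t \in `[0, T] -> x t = 0.
Proof.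
move=> T0 [cx dx] x0 t tT.
have [c hc] := qform_le A.
(* The identity matrix is inserted so that [is_derive_qform] applies to the squared norm. *)
pose q : R -> R := fun s => ((x s)^T *m 1%:M *m x s) 0 0.
pose e : R -> R := fun s => expR (- (2 * c) * s).
have dq (s : R) : s \in `]0, T[ ->
    is_derive s 1 q (2 * ((x s)^T *m 1%:M *m (A *m x s)) 0 0).
  by move=> sT; apply: is_derive_qform; [exact: trmx1|exact: dx].
have de (s : R) : is_derive s 1 e (- (2 * c) * e s).
  have h : is_derive s 1 (fun s : R => - (2 * c) * s) (- (2 * c)).
    apply: (is_derive_eq (is_deriveZ (- (2 * c)) (is_derive_id s 1))).
    by rewrite /GRing.scale/= mulr1.
  have := is_derive1_comp (is_derive_expR (- (2 * c) * s)) h.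
  by move=> {}h; apply: (is_derive_eq h); rewrite mulrC.
have dg (s : R) : s \in `]0, T[ -> is_derive s 1 (e * q)
    (2 * e s * (((x s)^T *m A *m x s) 0 0 - c * ((x s)^T *m x s) 0 0)).
  move=> sT; apply: (is_derive_eq (is_deriveM (de s) (dq s sT))).
  rewrite /GRing.scale/= /q !mulmx1 mulmxA; ring.
have cq : {within `[0, T], continuous q}.
  have : {within `[0, T], continuous (fun s => (x s)^T *m 1%:M *m x s)}.
    apply: continuous_mulmx => //; apply: continuous_mulmx.
      exact: continuous_trmx.
    by move=> s; exact: cvg_cst.
  by move=> /continuous_mxP/(_ 0 0).
have ce : {within `[0, T], continuous e}.
  apply: continuous_subspaceT => s.
  by apply/differentiable_continuous/derivable1_diffP; have [] := de s.
have /andP[t0 tT'] : 0 <= t <= T by rewrite in_itv in tT.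
have : (e * q) t <= (e * q) 0.
  apply: (@ler0_derive1_le_cc _ _ 0 T) => //; last by rewrite in_itv/= lexx ltW.
  - by move=> s sT; have [] := dg s sT.
  - move=> s sT; rewrite derive1E.
    have [_ ->] := dg s sT.
    by rewrite mulr_ge0_le0 ?mulr_ge0 ?expR_ge0// subr_le0.
  - by move=> s; apply: cvgM; [exact: ce|exact: cq].
(* The right-hand side vanishes since [x 0 = 0]. Dividing by the positive exponential leaves a
   squared norm that is at most 0, and it dominates the square of each coordinate. *)
rewrite /GRing.mul/= {2}/q x0 mulmx0 mxE mulr0 pmulr_rle0 ?expR_gt0//.
rewrite /q mulmx1 mxE => h.
apply/colP => i; rewrite mxE; apply/eqP; rewrite -sqrf_eq0 -[_ == _]andbT.
rewrite eq_le sqr_ge0 !andbT; apply: le_trans h.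
rewrite (bigD1 i)//= mxE expr2 lerDl sumr_ge0// => j _.
by rewrite mxE -expr2 sqr_ge0.
Qed.

(** * Negative semidefinite matrices *)

(** [M] may be rectangular: besides changes of basis this covers passing to principal blocks, with
    [M] selecting coordinates. *)
Lemma nsd_congr (R : realType) (n p : nat) (X : 'M[R]_n) (M : 'M[R]_(n, p)) :
  nsd X -> nsd (M^T *m X *m M).
Proof.
move=> [XT Xle]; split; first by rewrite !trmx_mul trmxK XT mulmxA.
by move=> v; have := Xle (M *m v); rewrite trmx_mul !mulmxA.
Qed.

Lemma nsd_qform0 (R : realType) (n : nat) (X : 'M[R]_n) (w : 'cV[R]_n) :
  nsd X -> (w^T *m X *m w) 0 0 = 0 -> X *m w = 0.
Proof.
move=> [XT Xle] w0.
(* With q v = v^T X v, q (v + t w) = q v + 2 t v^T X w <= 0 is affine in t. *)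
have vXw (v : 'cV[R]_n) : (v^T *m X *m w) 0 0 = 0.
  have q t : (v^T *m X *m v) 0 0 + 2 * t * (v^T *m X *m w) 0 0 <= 0.
    have := Xle (v + t *: w).
    have -> : (v + t *: w)^T = v^T + t *: w^T.
      by apply/matrixP => i j; rewrite !mxE.
    rewrite !mulmxDl !mulmxDr -!scalemxAl -!scalemxAr.
    have -> : w^T *m X *m v = (v^T *m X *m w)^T.
      by rewrite !trmx_mul trmxK XT mulmxA.
    rewrite !mxE in w0 *; rewrite w0.
    by set a := \sum_j _; set b := \sum_j _; lra.
  apply/eqP; apply/negPn/negP => /negP/negP b0.
  set a := (v^T *m X *m v) 0 0 in q; set b := (v^T *m X *m w) 0 0 in q b0.
  (* This value of [t] turns the affine expression into [a + (1 - a) = 1], which is not [<= 0]. *)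
  have := q ((1 - a) / (2 * b)); have -> : 2 * ((1 - a) / (2 * b)) * b = 1 - a.
    by field.
  by lra.
apply/colP => i; have := vXw (delta_mx i 0).
rewrite trmx_delta -mulmxA; set u := X *m w.
by rewrite -rowE !mxE.
Qed.

(** The quadratic form vanishes on vectors supported in the second block, so [nsd_qform0] puts them
    in the kernel; basis vectors then read off the columns of [X12]. Symmetry gives [X21]. *)
Lemma nsd_block0 (R : realType) (n p : nat) (X11 : 'M[R]_n) (X12 : 'M[R]_(n, p))
    (X21 : 'M[R]_(p, n)) :
  nsd (block_mx X11 X12 X21 (0 : 'M[R]_p)) -> X12 = 0 /\ X21 = 0.
Proof.
move=> X_nsd.
have X12_0 : X12 = 0.
  apply/matrixP => i j; pose w : 'cV[R]_(n + p) := col_mx 0 (delta_mx j 0).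
  have : block_mx X11 X12 X21 0 *m w = 0.
    apply: nsd_qform0 => //.
    rewrite -mulmxA mul_block_col !mulmx0 mul0mx addr0 add0r tr_col_mx trmx0.
    by rewrite mul_row_col mul0mx mulmx0 addr0 mxE.
  rewrite mul_block_col mulmx0 mul0mx add0r => /(congr1 usubmx).
  by rewrite col_mxKu -colE => /colP/(_ i); rewrite !mxE.
split=> //; have [+ _] := X_nsd.
by rewrite tr_block_mx => /eq_block_mx[_ _ <- _]; rewrite X12_0 trmx0.
Qed.

(** * Coordinate changes and the normal forms of P and S *)

Lemma cc_trK (R : realType) (n n' : nat) (V : coord_change R n n') :
  (cc_inv V)^T *m V^T = 1%:M.
Proof. by rewrite -trmx_mul cc_mxK trmx1. Qed.

(** Since x and p transform dually, [V] cancels against its inverse in every block. Only [W]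
    survives, acting as a congruence, so negative semidefiniteness is preserved. *)
Lemma gdi_mx_coord (R : realType) (n n' m : nat) (A : 'M[R]_n)
    (B : 'M[R]_(n, m)) (C : 'M[R]_(m, n)) (D : 'M[R]_m) (P S : 'M[R]_n)
    (V W : coord_change R n n') :
  gdi_mx (newA V A) (newB V B) (newC V C) D (newP V W P) (newS V W S) =
  (block_mx (cc_mx W) 0 0 1%:M)^T *m gdi_mx A B C D P S
    *m block_mx (cc_mx W) 0 0 1%:M.
Proof.
rewrite /gdi_mx tr_block_mx !mulmx_block.
rewrite !trmx0 trmx1 !mul0mx !mulmx0 !mul1mx !mulmx1 !addr0 !add0r.
have newST : (newS V W S)^T = W^T *m S^T *m V.
  by rewrite /newS !trmx_mul trmxK mulmxA.
have VnewP : V *m newP V W P = P *m W.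
  by rewrite /newP !mulmxA cc_mxK mul1mx.
have newPT : (newP V W P)^T *m V^T = W^T *m P^T.
  by rewrite -trmx_mul VnewP trmx_mul.
move: (newP V W P) VnewP newPT => P' VnewP newPT.
congr block_mx.
- rewrite mulmxDr mulmxDl; congr (_ + _).
    by rewrite newST /newA -!mulmxA VnewP (mulmxA (cc_mx V)) cc_mxK mul1mx.
  rewrite /newA !trmx_mul !mulmxA newPT ?mulmxA.
  by rewrite -(mulmxA _ (cc_inv V)^T) cc_trK mulmx1.
- rewrite mulmxBr; congr (_ - _).
    by rewrite newST /newB -!mulmxA (mulmxA (cc_mx V)) cc_mxK mul1mx.
  by rewrite /newC trmx_mul mulmxA newPT -mulmxA.
- rewrite mulmxBl; congr (_ - _); last by rewrite /newC -mulmxA VnewP mulmxA.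
  rewrite /newB /newS trmx_mul !mulmxA.
  by rewrite -(mulmxA _ (cc_inv V)^T) cc_trK mulmx1.
Qed.

(** Gaussian elimination factors [P] as [col_ebase P], a partial identity, and [row_ebase P]; the
    first factor serves as [V] and the inverse of the last as [W]. *)
Lemma rank_normal_form (R : realType) (n k l : nat) (P : 'M[R]_n) :
  (k + l = n)%N -> \rank P = k ->
  exists V W : coord_change R n (k + l), newP V W P = block_mx 1%:M 0 0 0.
Proof.
move=> kln rkP; subst n.
have cu := col_ebase_unit P; have ru := row_ebase_unit P.
exists (CoordChange (mulmxV cu) (mulVmx cu)).
exists (CoordChange (mulVmx ru) (mulmxV ru)).
rewrite /newP/= -{2}(mulmx_ebase P) !mulmxA mulVmx// mul1mx.
by rewrite mulmxK// rkP pid_mx_block.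
Qed.

(** A further change of basis on the parametrization space, kept transparent so that its matrix
    reduces to [W *m M]. *)
Definition cc_mulmx (R : realType) (n n' : nat) (W : coord_change R n n')
    (M : 'M[R]_n') (uM : M \in unitmx) : coord_change R n n'.
Proof.
apply: (@CoordChange _ _ _ (cc_mx W *m M) (invmx M *m cc_inv W)).
  by rewrite mulmxA mulmxK// cc_mxK.
by rewrite mulmxA -(mulmxA _ (cc_inv W)) cc_invK mulmx1 mulVmx.
Defined.

Lemma newS_form (R : realType) (n k l : nat) (P S : 'M[R]_n)
    (hPS : S^T *m P = P^T *m S) (hrank : \rank (col_mx P S) = n)
    (V W : coord_change R n (k + l)) :
  newP V W P = block_mx 1%:M 0 0 0 ->
  [/\ (ulsubmx (newS V W S))^T = ulsubmx (newS V W S),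
      ursubmx (newS V W S) = 0 & drsubmx (newS V W S) \in unitmx].
Proof.
move=> hP.
have : (newS V W S)^T *m newP V W P = (newP V W P)^T *m newS V W S.
  rewrite /newP /newS !trmx_mul trmxK !mulmxA.
  rewrite -(mulmxA _ V) cc_mxK mulmx1 -(mulmxA _ (cc_inv V)^T) cc_trK.
  by rewrite mulmx1 -(mulmxA _ S^T) hPS mulmxA.
rewrite hP -{1 2}[newS V W S]submxK tr_block_mx tr_block_mx !mulmx_block.
rewrite !trmx0 trmx1 !mul0mx !mulmx0 !mul1mx !mulmx1 !addr0.
move=> /eq_block_mx[S11T /esym S12 _ _]; split=> //.
apply/negPn/negP; set S22 := drsubmx _; rewrite -unitmx_tr unitmxE unitfE.
move=> /negPn/det0P[v v0 vS22]; case/negP: v0.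
have S22v : S22 *m v^T = 0 by rewrite -[S22]trmxK -trmx_mul vS22 trmx0.
(* A kernel vector of [S22], padded by zero, is killed by the new [P], which sees only the first
   block, and by the new [S], because its (1,2) block is zero. Thus [u] lies in the kernel of
   [col_mx P S], which is trivial by the rank condition. *)
pose u : 'cV[R]_n := W *m col_mx 0 v^T.
have Pu : P *m u = 0.
  have : cc_inv V *m (P *m u) = 0.
    rewrite !mulmxA -[cc_inv V *m P *m W]/(newP V W P) hP mul_block_col.
    by rewrite !mul0mx mulmx0 !addr0 col_mx0.
  by move=> /(congr1 (mulmx V)); rewrite mulmxA cc_mxK mul1mx mulmx0.
have Su : S *m u = 0.
  have : V^T *m (S *m u) = 0.
    rewrite !mulmxA -[V^T *m S *m W]/(newS V W S) -[newS V W S]submxK.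
    by rewrite S12 mul_block_col !mulmx0 mul0mx S22v !addr0 col_mx0.
  move=> /(congr1 (mulmx (cc_inv V)^T)).
  by rewrite mulmxA cc_trK mul1mx mulmx0.
have /row_fullP[G GPS] : row_full (col_mx P S) by rewrite /row_full hrank.
have u0 : u = 0.
  by rewrite -[u]mul1mx -GPS -mulmxA mul_col_mx Pu Su col_mx0 mulmx0.
have /(congr1 dsubmx) : col_mx 0 v^T = 0 :> 'cV_(k + l).
  by rewrite -[LHS]mul1mx -(cc_invK W) -mulmxA -/u u0 mulmx0.
by rewrite col_mxKd => vT0; rewrite -[v]trmxK vT0 !linear0.
Qed.

(** The relation between [P] and [S] leaves the (2,1) block of [S] free, but column operations on z
    remove it. The matrix [M] subtracts [S21] by means of the invertible [S22] and scales [S22] to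
    the identity; its first block row is [[I 0]], so the normal form of [P] is untouched. *)
Lemma newS_block_diag (R : realType) (n k l : nat) (P S : 'M[R]_n)
    (V W : coord_change R n (k + l)) :
  newP V W P = block_mx 1%:M 0 0 0 -> ursubmx (newS V W S) = 0 ->
  drsubmx (newS V W S) \in unitmx ->
  exists W' : coord_change R n (k + l),
    newP V W' P = block_mx 1%:M 0 0 0 /\
    newS V W' S = block_mx (ulsubmx (newS V W S)) 0 0 1%:M.
Proof.
move=> hP S12; set S22 := drsubmx _ => uS22; set S21 := dlsubmx (newS V W S).
pose M := block_mx (1%:M : 'M[R]_k) 0 (- (invmx S22 *m S21)) (invmx S22).
have uM : M \in unitmx.
  by rewrite unitmxE det_lblock det1 mul1r -unitmxE unitmx_inv.
exists (cc_mulmx W uM); split.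
  rewrite /newP/= mulmxA -/(newP V W P) hP mulmx_block.
  by rewrite !mul0mx !mul1mx !addr0.
rewrite /newS/= mulmxA -/(newS V W S) -{1}[newS V W S]submxK S12 mulmx_block.
rewrite !mul0mx !mulmx0 !mulmx1 !add0r addr0 mulmxN mulKVmx// subrr.
by rewrite mulmxV.
Qed.

(** * The block form of the generalized dissipation inequality *)

Lemma gdi_mx_block (R : realType) (k l m : nat) (A : 'M[R]_(k + l))
    (B : 'M[R]_(k + l, m)) (C : 'M[R]_(m, k + l)) (D : 'M[R]_m)
    (S11 : 'M[R]_k) (S22 : 'M[R]_l) :
  S11^T = S11 -> S22^T = S22 ->
  gdi_mx A B C D (block_mx 1%:M 0 0 0) (block_mx S11 0 0 S22) =
  block_mx
    (block_mx ((ulsubmx A)^T *m S11 + S11 *m ulsubmx A)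
              ((dlsubmx A)^T *m S22) (S22 *m dlsubmx A) 0)
    (col_mx (S11 *m usubmx B - (lsubmx C)^T) (S22 *m dsubmx B))
    (row_mx ((usubmx B)^T *m S11 - lsubmx C) ((dsubmx B)^T *m S22))
    (- D - D^T).
Proof.
move=> S11T S22T; rewrite /gdi_mx.
rewrite -{1 2}(submxK A) -{1 2}(vsubmxK B) -{1 2}(hsubmxK C).
rewrite !tr_block_mx tr_col_mx tr_row_mx S11T S22T !trmx0 trmx1.
rewrite !mulmx_block !mul_block_col !mul_row_block.
rewrite ?mul0mx ?mulmx0 ?mul1mx ?mulmx1 ?addr0 ?add0r.
rewrite add_block_mx opp_col_mx add_col_mx opp_row_mx add_row_mx.
by rewrite !oppr0 !addr0 !add0r !mul0mx addr0 [X in block_mx X _ _ 0]addrC.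
Qed.

Lemma nsd_gdi_blocks (R : realType) (k l m : nat) (X11 : 'M[R]_k)
    (X12 : 'M[R]_(k, l)) (X21 : 'M[R]_(l, k)) (X13 : 'M[R]_(k, m))
    (X23 : 'M[R]_(l, m)) (X31 : 'M[R]_(m, k)) (X32 : 'M[R]_(m, l))
    (X33 : 'M[R]_m) :
  nsd (block_mx (block_mx X11 X12 X21 0) (col_mx X13 X23)
                (row_mx X31 X32) X33) ->
  [/\ X21 = 0, X23 = 0 & nsd (block_mx X11 X13 X31 X33)].
Proof.
move=> X_nsd.
have X21_0 : X21 = 0.
  have /nsd_block0[] // : nsd (block_mx X11 X12 X21 0).
  (* Selects blocks 1 and 2. *)
  have := nsd_congr (col_mx 1%:M 0) X_nsd.
  rewrite tr_col_mx trmx1 trmx0 mul_row_block mul_row_col.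
  by rewrite !mul0mx !mulmx0 mul1mx mulmx1 !addr0.
have X23_0 : X23 = 0.
  have /nsd_block0[] // : nsd (block_mx X33 X32 X23 0).
  (* Selects blocks 3 and 2 in this order, so that the zero diagonal block comes last as
     [nsd_block0] requires. *)
  have := nsd_congr (block_mx (0 : 'M[R]_(k + l, m)) (col_mx 0 1%:M) 1%:M 0) X_nsd.
  rewrite tr_block_mx tr_col_mx !trmx0 !trmx1 !mulmx_block.
  rewrite ?mul0mx ?mulmx0 ?mul1mx ?mulmx1 ?addr0 ?add0r.
  rewrite !mul_row_block !mul_row_col.
  by rewrite ?mul0mx ?mulmx0 ?mul1mx ?mulmx1 ?addr0 ?add0r.
split=> //.
(* Selects blocks 1 and 3, which gives the reduced inequality. *)
have := nsd_congr (block_mx (col_mx 1%:M 0) (0 : 'M[R]_(k + l, m)) 0 1%:M) X_nsd.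
rewrite tr_block_mx tr_col_mx !trmx0 !trmx1 !mulmx_block.
rewrite ?mul0mx ?mulmx0 ?mul1mx ?mulmx1 ?addr0 ?add0r.
rewrite !mul_row_block !mul_row_col.
by rewrite ?mul0mx ?mulmx0 ?mul1mx ?mulmx1 ?addr0 ?add0r.
Qed.

(** * From the matrix inequality to the storage function *)

Lemma nsd_dissipation (R : realType) (n m : nat) (A : 'M[R]_n)
    (B : 'M[R]_(n, m)) (C : 'M[R]_(m, n)) (D : 'M[R]_m) (Q : 'M[R]_n) :
  Q^T = Q ->
  nsd (block_mx (A^T *m Q + Q *m A) (Q *m B - C^T)
                (B^T *m Q - C) (- D - D^T)) ->
  dissipation_inequality A B C D (quadratic_storage Q).
Proof.
move=> QT [_ nsdX] T x u y T0 [[_ dx] xy] t tT.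
have h : is_derive t 1 (quadratic_storage Q \o x)
    (((x t)^T *m Q *m (A *m x t + B *m u t)) 0 0).
  apply: (is_derive_eq (is_deriveZ 2^-1 (is_derive_qform QT (dx t tT)))).
  by rewrite /GRing.scale/= mulKf.
have [dH ->] := h; split=> //.
rewrite xy; last exact: subset_itv_oo_cc.
(* At the vector with components [x t] and [u t] the quadratic form equals twice the difference
   between the derivative of the storage function and [y^T u]. *)
have := nsdX (col_mx (x t) (u t)).
move: (x t) (u t) => {dx dH h xy}x {}u.
rewrite -mulmxA mul_block_col tr_col_mx mul_row_col.
have -> : (C *m x + D *m u)^T *m u = u^T *m (C *m x + D *m u).
  rewrite -[RHS]trmxK [in RHS]trmx_mul trmxK.
  by apply/matrixP => i j; rewrite !ord1 [RHS]mxE.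
rewrite !mulmxDl !mulmxDr !mulNmx !mulmxN.
(* Each scalar is a 1 x 1 matrix equal to its transpose; this brings the paired terms to a common
   form before the linear arithmetic. *)
have sc (Z : 'M[R]_1) : Z = Z^T by apply/matrixP => i j; rewrite !ord1 mxE.
rewrite (sc (x^T *m (A^T *m Q *m x))) (sc (u^T *m (B^T *m Q *m x))).
rewrite (sc (x^T *m (C^T *m u))) (sc (u^T *m (D^T *m u))).
rewrite !trmx_mul !trmxK !QT !mulmxA.
set a := x^T *m Q *m A *m x; set b := x^T *m Q *m B *m u.
set c := u^T *m C *m x; set d := u^T *m D *m u.
by rewrite !mxE; lra.
Qed.

(** * Solutions in block coordinates *)

Lemma solves_ode_cc (R : realType) (n n' : nat) (V : coord_change R n n')
    (T : R) (x f : R -> 'cV[R]_n) :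
  solves_ode T x f <->
  solves_ode T (fun t => cc_inv V *m x t) (fun t => cc_inv V *m f t).
Proof.
split; first exact: solves_ode_mulmx.
move=> /(solves_ode_mulmx V); apply: eq_solves_ode => t _;
  by rewrite mulmxA cc_mxK mul1mx.
Qed.

Lemma solves_ode_submx (R : realType) (k l : nat) (T : R)
    (x f : R -> 'cV[R]_(k + l)) :
  solves_ode T x f <->
  solves_ode T (fun t => usubmx (x t)) (fun t => usubmx (f t)) /\
  solves_ode T (fun t => dsubmx (x t)) (fun t => dsubmx (f t)).
Proof.
split=> [hx|[hu hd]].
  split.
    have := solves_ode_mulmx (row_mx 1%:M 0) hx.
    by apply: eq_solves_ode => t _; rewrite -{1}(vsubmxK (_ t)) mul_row_col
      mul1mx mul0mx addr0.
  have := solves_ode_mulmx (row_mx 0 1%:M) hx.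
  by apply: eq_solves_ode => t _; rewrite -{1}(vsubmxK (_ t)) mul_row_col
    mul1mx mul0mx add0r.
have := solves_odeD (solves_ode_mulmx (col_mx 1%:M 0) hu)
  (solves_ode_mulmx (col_mx 0 1%:M) hd).
by apply: eq_solves_ode => t _; rewrite !mul_col_mx add_col_mx
  !mul1mx !mul0mx add0r addr0 vsubmxK.
Qed.

(** * The image of P and the controllable part *)

Lemma im_mx_coord (R : realType) (n k l : nat) (P : 'M[R]_n)
    (V W : coord_change R n (k + l)) :
  newP V W P = block_mx 1%:M 0 0 0 ->
  forall x, im_mx P x <-> dsubmx (cc_inv V *m x) = 0.
Proof.
move=> hP x.
have VP z : cc_inv V *m (P *m (W *m z)) = newP V W P *m z.
  by rewrite /newP !mulmxA.
split=> [[z _ <-]|x2].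
  rewrite -[z]mul1mx -(cc_mxK W) -mulmxA VP hP.
  by rewrite -[cc_inv W *m z]vsubmxK mul_block_col !mul0mx !addr0 col_mxKd.
(* On vectors with zero second block the normal form of [P] acts as the identity, so the coordinates
   of [x] themselves serve as parameter z. *)
exists (W *m (cc_inv V *m x)) => //.
rewrite -[LHS]mul1mx -(cc_mxK V) -mulmxA VP hP.
rewrite -{1}(vsubmxK (cc_inv V *m x)) x2 mul_block_col !mul0mx mul1mx.
by rewrite !addr0 -[X in col_mx _ X]x2 vsubmxK mulmxA cc_mxK mul1mx.
Qed.

(** The kernel of [K] is an [A]-invariant subspace containing the image of [B]: moving [K] past the
    powers of [A] ends in [K *m B = 0]. *)
Lemma controllable_subspace_sub_ker (R : realType) (n m p : nat) (A : 'M[R]_n)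
    (B : 'M[R]_(n, m)) (K : 'M[R]_(p, n)) (F : 'M[R]_p) :
  K *m A = F *m K -> K *m B = 0 ->
  forall x, controllable_subspace A B x -> K *m x = 0.
Proof.
move=> KA KB _ [z _ <-].
have KAjB j : K *m (A ^+ j *m B) = 0.
  elim: j => [|j IHj]; first by rewrite expr0 mul1mx.
  by rewrite exprS -[_ * _]/(_ *m _) -mulmxA mulmxA KA -mulmxA IHj mulmx0.
rewrite mulmxA mul_mxrow.
have -> : \mxrow_(j < n) (K *m (A ^+ j *m B)) = 0.
  by rewrite -[RHS]mxrow0; apply/eq_mxrowP => j; exact: KAjB.
by rewrite mul0mx.
Qed.

(** Applying [K] removes the input: [K *m x t] solves the autonomous equation with matrix [F] and
    starts at 0, so it stays at 0. *)
Lemma reachable_sub_ker (R : realType) (n m p : nat) (A : 'M[R]_n)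
    (B : 'M[R]_(n, m)) (K : 'M[R]_(p, n)) (F : 'M[R]_p) :
  K *m A = F *m K -> K *m B = 0 ->
  forall x, reachable_from_0 A B x -> K *m x = 0.
Proof.
move=> KA KB _ [T [x [u [T0 hx x0 <-]]]].
have hKx : solves_ode T (fun t => K *m x t) (fun t => F *m (K *m x t)).
  have := solves_ode_mulmx K hx; apply: eq_solves_ode => // t _.
  by rewrite mulmxDr !mulmxA KA KB mul0mx addr0.
apply: (solves_ode_unique0 T0 hKx) => /=; first by rewrite x0 mulmx0.
by rewrite in_itv/= lexx ltW.
Qed.

(** Controllability reaches every basis vector from 0, so [P] is onto; a row vector annihilating [P]
    then has all its coordinates zero. *)
Lemma controllable_im_unitmx (R : realType) (n m : nat) (A P : 'M[R]_n)
    (B : 'M[R]_(n, m)) :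
  reachable_from_0 A B `<=` im_mx P -> controllable A B -> P \in unitmx.
Proof.
move=> reachP AB_ctrl; apply/negPn/negP.
rewrite unitmxE unitfE => /negPn/det0P[v v0 vP]; case/negP: v0.
apply/eqP/rowP => i.
have [z _ zi] := reachP (delta_mx i 0) (AB_ctrl _ _).
by rewrite mxE -[v 0 i]mul1r; have := congr1 (fun X => (v *m X) 0 0) zi;
  rewrite /= mulmxA vP mul0mx -colE !mxE mul1r.
Qed.

(** * The block-triangular and the reduced system *)

Lemma gdi_block_triangular (R : realType) (n k l m : nat) (A : 'M[R]_n)
    (B : 'M[R]_(n, m)) (C : 'M[R]_(m, n)) (D : 'M[R]_m) (P S : 'M[R]_n)
    (V W : coord_change R n (k + l)) (S11 : 'M[R]_k) (S22 : 'M[R]_l) :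
  nsd (gdi_mx A B C D P S) ->
  newP V W P = block_mx 1%:M 0 0 0 -> newS V W S = block_mx S11 0 0 S22 ->
  S11^T = S11 -> S22^T = S22 -> S22 \in unitmx ->
  let A11 := ulsubmx (newA V A) in
  let A21 := dlsubmx (newA V A) in
  let B1 := usubmx (newB V B) in
  let B2 := dsubmx (newB V B) in
  let C1 := lsubmx (newC V C) in
  let M := block_mx
    (block_mx (A11^T *m S11 + S11 *m A11) (A21^T *m S22)
              (S22 *m A21)                0)
    (col_mx (S11 *m B1 - C1^T) (S22 *m B2))
    (row_mx (B1^T *m S11 - C1) (B2^T *m S22))
    (- D - D^T) in
  [/\ gdi_mx (newA V A) (newB V B) (newC V C) D
        (newP V W P) (newS V W S) = M /\ nsd M,
      A21 = 0 /\ B2 = 0 &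
      nsd (block_mx (A11^T *m S11 + S11 *m A11) (S11 *m B1 - C1^T)
                    (B1^T *m S11 - C1)          (- D - D^T))].
Proof.
move=> hgdi hP hS S11T S22T uS22 A11 A21 B1 B2 C1 M.
have gdiM : gdi_mx (newA V A) (newB V B) (newC V C) D
    (newP V W P) (newS V W S) = M by rewrite hP hS gdi_mx_block.
have M_nsd : nsd M by rewrite -gdiM gdi_mx_coord; exact: nsd_congr.
have [A21_0 B2_0 red_nsd] := nsd_gdi_blocks M_nsd.
split=> //; split.
  by rewrite -[A21](mulKmx uS22) A21_0 mulmx0.
by rewrite -[B2](mulKmx uS22) B2_0 mulmx0.
Qed.

Lemma cc_dsubmx (R : realType) (n k l p : nat) (V : coord_change R n (k + l))
    (X : 'M[R]_(n, p)) :
  dsubmx (cc_inv V *m X) = row_mx 0 1%:M *m cc_inv V *m X.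
Proof.
by rewrite -mulmxA -[in RHS](vsubmxK (cc_inv V *m X)) mul_row_col mul0mx mul1mx
  add0r.
Qed.

(** The bottom block row of the new [A] is [[0 A22]], so the projection to the second coordinates
    follows [A22] alone. It supplies the [K] and [F] of the two kernel lemmas. *)
Lemma newA_intertwine (R : realType) (n k l : nat)
    (V : coord_change R n (k + l)) (A : 'M[R]_n) :
  dlsubmx (newA V A) = 0 ->
  row_mx 0 1%:M *m cc_inv V *m A =
  drsubmx (newA V A) *m (row_mx 0 1%:M *m cc_inv V).
Proof.
move=> A21_0.
have VA : cc_inv V *m A = newA V A *m cc_inv V.
  by rewrite /newA -!mulmxA cc_mxK mulmx1.
rewrite -mulmxA VA; move: (newA V A) A21_0 => A' A21_0.
rewrite !mulmxA -{1}(submxK A') A21_0.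
by rewrite mul_row_block mul_mx_row !mul0mx !mul1mx mulmx0 mulmx1 !add0r.
Qed.

Lemma cc_vector_field (R : realType) (n k l m : nat)
    (V : coord_change R n (k + l)) (A : 'M[R]_n) (B : 'M[R]_(n, m)) x u :
  cc_inv V *m (A *m x + B *m u) =
  col_mx (ulsubmx (newA V A) *m usubmx (cc_inv V *m x)
          + ursubmx (newA V A) *m dsubmx (cc_inv V *m x)
          + usubmx (newB V B) *m u)
         (dlsubmx (newA V A) *m usubmx (cc_inv V *m x)
          + drsubmx (newA V A) *m dsubmx (cc_inv V *m x)
          + dsubmx (newB V B) *m u) :> 'cV[R]_(k + l).
Proof.
rewrite -add_col_mx -mul_block_col -mul_col_mx submxK !vsubmxK.
rewrite mulmxDr /newB; congr (_ + _); last by rewrite mulmxA.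
by rewrite /newA -!mulmxA (mulmxA (cc_mx V)) cc_mxK mul1mx.
Qed.

Lemma trajectory_block_triangular (R : realType) (n k l m : nat) (A : 'M[R]_n)
    (B : 'M[R]_(n, m)) (C : 'M[R]_(m, n)) (D : 'M[R]_m)
    (V : coord_change R n (k + l)) (T : R) (x : R -> 'cV[R]_n)
    (u y : R -> 'cV[R]_m) :
  dlsubmx (newA V A) = 0 -> dsubmx (newB V B) = 0 ->
  let x1 t := usubmx (cc_inv V *m x t) in
  let x2 t := dsubmx (cc_inv V *m x t) in
  trajectory A B C D T x u y <->
  [/\ solves_ode T x1
        (fun t => ulsubmx (newA V A) *m x1 t + ursubmx (newA V A) *m x2 t
                  + usubmx (newB V B) *m u t),
      solves_ode T x2 (fun t => drsubmx (newA V A) *m x2 t) &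
      forall t, t \in `[0, T] ->
        y t = lsubmx (newC V C) *m x1 t + rsubmx (newC V C) *m x2 t
              + D *m u t].
Proof.
move=> A21_0 B2_0 x1 x2.
have field t : cc_inv V *m (A *m x t + B *m u t) =
    col_mx (ulsubmx (newA V A) *m x1 t + ursubmx (newA V A) *m x2 t
            + usubmx (newB V B) *m u t) (drsubmx (newA V A) *m x2 t).
  by rewrite cc_vector_field A21_0 B2_0 !mul0mx add0r addr0.
have output t : C *m x t = lsubmx (newC V C) *m x1 t + rsubmx (newC V C) *m x2 t.
  rewrite -mul_row_col hsubmxK vsubmxK /newC -mulmxA (mulmxA (cc_mx V)).
  by rewrite cc_mxK mul1mx.
rewrite /trajectory (solves_ode_cc V) solves_ode_submx.
split=> [[[h1 h2] hy]|[h1 h2 hy]]; split.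
- by apply: eq_solves_ode h1 => // t _; rewrite field col_mxKu.
- by apply: eq_solves_ode h2 => // t _; rewrite field col_mxKd.
- by move=> t tT; rewrite hy// output.
- split.
    by apply: eq_solves_ode h1 => // t _; rewrite field col_mxKu.
  by apply: eq_solves_ode h2 => // t _; rewrite field col_mxKd.
- by move=> t tT; rewrite hy// output.
Qed.

Lemma trajectory_reduced (R : realType) (n k l m : nat) (A : 'M[R]_n)
    (B : 'M[R]_(n, m)) (C : 'M[R]_(m, n)) (D : 'M[R]_m)
    (V : coord_change R n (k + l)) (T : R) (x : R -> 'cV[R]_n)
    (u y : R -> 'cV[R]_m) :
  dlsubmx (newA V A) = 0 -> dsubmx (newB V B) = 0 -> 0 < T ->
  let x1 t := usubmx (cc_inv V *m x t) in
  let x2 t := dsubmx (cc_inv V *m x t) in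
  x2 0 = 0 ->
  trajectory A B C D T x u y <->
  (forall t, t \in `[0, T] -> x2 t = 0) /\
  trajectory (ulsubmx (newA V A)) (usubmx (newB V B)) (lsubmx (newC V C)) D
    T x1 u y.
Proof.
move=> A21_0 B2_0 T0 x1 x2 x20.
rewrite (trajectory_block_triangular _ _ _ _ _ _ A21_0 B2_0).
split=> [[h1 h2 hy]|[hx2 [h1 hy]]].
  have hx2 : forall t, t \in `[0, T] -> x2 t = 0.
    exact: solves_ode_unique0 T0 h2 x20.
  split=> //; split.
    apply: eq_solves_ode h1 => // t /subset_itv_oo_cc tT.
    by rewrite -/(x2 t) hx2// mulmx0 addr0.
  by move=> t tT; rewrite hy// -/(x2 t) hx2// mulmx0 addr0.
split.
- apply: eq_solves_ode h1 => // t /subset_itv_oo_cc tT.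
  by rewrite -/(x2 t) hx2// mulmx0 addr0.
(* For the converse, the equation for [x2] is that of the constant zero function, with which [x2]
   agrees on [[0, T]]. *)
- apply: (@eq_solves_ode _ _ _ (fun=> 0) x2 (fun=> 0)) => [t tT|t tT|].
  + by rewrite /= -/(x2 t) hx2.
  + by rewrite /= -/(x2 t) hx2 ?mulmx0//; exact: subset_itv_oo_cc.
  + by split=> [t|t _]; [exact: cvg_cst|exact: is_derive_cst].
- by move=> t tT; rewrite hy// -/(x2 t) hx2// mulmx0 addr0.
Qed.

Theorem mainTheorem3 (R : realType) (n m : nat)
    (A : 'M[R]_n) (B : 'M[R]_(n, m)) (C : 'M[R]_(m, n)) (D : 'M[R]_m)
    (P S : 'M[R]_n)
    (hPS : S^T *m P = P^T *m S)
    (hrank : \rank (col_mx P S) = n)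
    (hgdi : nsd (gdi_mx A B C D P S)) :
  let k := \rank P in
  let l := (n - \rank P)%N in
  [/\ (* P can be brought to the form diag(I_k, 0) *)
      exists V W : coord_change R n (k + l),
        newP V W P = block_mx 1%:M 0 0 0,
      (* in any such coordinates, the form of S; the coordinates on Z are
         adapted by W', which leaves P and S_11 unchanged *)
      forall V W : coord_change R n (k + l),
        newP V W P = block_mx 1%:M 0 0 0 ->
        let S11 := ulsubmx (newS V W S) in
        [/\ S11^T = S11, ursubmx (newS V W S) = 0,
            drsubmx (newS V W S) \in unitmx &
            exists (W' : coord_change R n (k + l)) (S22 : 'M[R]_l),
              [/\ newP V W' P = block_mx 1%:M 0 0 0,
                  newS V W' S = block_mx S11 0 0 S22,
                  S22^T = S22 & S22 \in unitmx]],
      (* the system in coordinates where P and S have these forms *)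
      forall (V W : coord_change R n (k + l)) (S11 : 'M[R]_k) (S22 : 'M[R]_l),
        newP V W P = block_mx 1%:M 0 0 0 ->
        newS V W S = block_mx S11 0 0 S22 ->
        S11^T = S11 -> S22^T = S22 ->
        let A11 := ulsubmx (newA V A) in
        let A12 := ursubmx (newA V A) in
        let A21 := dlsubmx (newA V A) in
        let A22 := drsubmx (newA V A) in
        let B1 := usubmx (newB V B) in
        let B2 := dsubmx (newB V B) in
        let C1 := lsubmx (newC V C) in
        let C2 := rsubmx (newC V C) in
        let x1 (x : R -> 'cV[R]_n) (t : R) : 'cV[R]_k :=
          usubmx (cc_inv V *m x t) in
        let x2 (x : R -> 'cV[R]_n) (t : R) : 'cV[R]_l :=
          dsubmx (cc_inv V *m x t) in
        let M := block_mx
          (block_mx (A11^T *m S11 + S11 *m A11) (A21^T *m S22)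
                    (S22 *m A21)                0)
          (col_mx (S11 *m B1 - C1^T) (S22 *m B2))
          (row_mx (B1^T *m S11 - C1) (B2^T *m S22))
          (- D - D^T) in
        [/\ gdi_mx (newA V A) (newB V B) (newC V C) D
              (newP V W P) (newS V W S) = M /\ nsd M,
            A21 = 0 /\ B2 = 0,
            forall (T : R) (x : R -> 'cV[R]_n) (u y : R -> 'cV[R]_m), 0 < T ->
              (trajectory A B C D T x u y <->
               [/\ solves_ode T (x1 x)
                     (fun t => A11 *m x1 x t + A12 *m x2 x t + B1 *m u t),
                   solves_ode T (x2 x) (fun t => A22 *m x2 x t) &
                   forall t : R, t \in `[0, T] ->
                     y t = C1 *m x1 x t + C2 *m x2 x t + D *m u t]),
            nsd (block_mx (A11^T *m S11 + S11 *m A11) (S11 *m B1 - C1^T)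
                          (B1^T *m S11 - C1)          (- D - D^T)) &
            (forall (T : R) (x : R -> 'cV[R]_n) (u y : R -> 'cV[R]_m),
               0 < T -> x2 x 0 = 0 ->
               (trajectory A B C D T x u y <->
                (forall t : R, t \in `[0, T] -> x2 x t = 0) /\
                trajectory A11 B1 C1 D T (x1 x) u y)) /\
            dissipation_inequality A11 B1 C1 D (quadratic_storage S11)] &
      (* uncontrollability *)
      [/\ P \notin unitmx -> ~ controllable A B,
          controllable_subspace A B `<=` im_mx P &
          reachable_from_0 A B `<=` im_mx P]].
Proof.
(* The natural-number subtraction does not truncate, because the rank is at most [n]. *)
have kl : (\rank P + (n - \rank P) = n)%N by rewrite subnKC// rank_leq_row.
move=> k l.
have normal_form : exists V W : coord_change R n (k + l),
    newP V W P = block_mx 1%:M 0 0 0 by exact: rank_normal_form.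
have form_S (V W : coord_change R n (k + l)) :
    newP V W P = block_mx 1%:M 0 0 0 ->
    [/\ (ulsubmx (newS V W S))^T = ulsubmx (newS V W S),
        ursubmx (newS V W S) = 0 & drsubmx (newS V W S) \in unitmx].
  exact: newS_form.
split=> //.
- move=> V W hP S11; have [S11T S12 uS22] := form_S V W hP.
  have [W' [hP' hS']] := newS_block_diag hP S12 uS22.
  (* The second diagonal block has been scaled to the identity, which is symmetric and
     invertible. *)
  split=> //; exists W', 1%:M; split=> //; first exact: trmx1.
  exact: unitmx1.
- move=> V W S11 S22 hP hS S11T S22T A11 A12 A21 A22 B1 B2 C1 C2 x1 x2 M.
  (* Invertibility is inherited from the rank condition through [form_S]. *)
  have uS22 : S22 \in unitmx.
    by have [_ _] := form_S V W hP; rewrite hS block_mxKdr.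
  have [gdiM [A21_0 B2_0] red_nsd] :=
    gdi_block_triangular hgdi hP hS S11T S22T uS22.
  split=> //.
  + by move=> T x u y _; exact: trajectory_block_triangular.
  + split; last exact: nsd_dissipation.
    by move=> T x u y T0 x20; exact: trajectory_reduced.
have [V [W hP]] := normal_form.
have [S11T S12 uS22] := form_S V W hP.
(* The coordinates on the state space stay fixed by [V]; replacing [W] by [W'] makes [S] block
   diagonal, so that the zero blocks of [A] and [B] follow. *)
have [W' [hP' hS']] := newS_block_diag hP S12 uS22.
have [_ [A21_0 B2_0] _] := gdi_block_triangular hgdi hP' hS' S11T
  (trmx1 _ _) (unitmx1 _ _).
have KA := newA_intertwine A21_0.
have KB : row_mx 0 1%:M *m cc_inv V *m B = 0 by rewrite -cc_dsubmx.
have reachP : reachable_from_0 A B `<=` im_mx P.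
  move=> x hx; apply/(im_mx_coord hP); rewrite cc_dsubmx.
  exact: reachable_sub_ker KA KB _ hx.
split=> //.
- by move=> /negP uP AB_ctrl; apply: uP; exact: controllable_im_unitmx AB_ctrl.
- move=> x hx; apply/(im_mx_coord hP); rewrite cc_dsubmx.
  exact: controllable_subspace_sub_ker KA KB _ hx.
Qed.
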